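(* Let $N$ be an even positive integer, let $L$ be a positive integer with $L \le N$, and let $h_0, h_1$ be real filters of length $L$, i.e. $h_c = (h_c(0), \dots, h_c(L-1)) \in \mathbb{R}^L$ for $c \in \{0,1\}$. Define the $N \times N$ real matrix $\mathbf{T}_s$ as follows. For $m = 0, 1, \dots, N/2 - 1$ and $c \in \{0,1\}$, row number $2m + 1 + c$ of $\mathbf{T}_s$ has entry $h_c(L-1-\ell)$ in column $((2m + \ell) \bmod N) + 1$ for $\ell = 0, \dots, L-1$, and zeros in all other columns. Thus consecutive pairs of rows are shifted by two columns, with indices taken modulo $N$. Assume $\mathbf{T}_s$ is invertible. Define the interleaver $\Pi : \{1, \dots, N\} \to \{1, \dots, N\}$ by $\Pi(i) = ((i - 1 + N/2) \bmod N) + 1$. Let $\mathbf{T}_\Pi$ be the $N \times N$ matrix whose $i$-th row is row $\Pi(i)$ of $\mathbf{T}_s$. Let $$\mathbf{T} = \begin{pmatrix} \mathbf{T}_s \\ \mathbf{T}_\Pi \end{pmatrix} \in \mathbb{R}^{2N \times N},$$ and for an information vector $x \in \mathbb{R}^N$ let $y = \mathbf{T}x = (y_1, \dots, y_{2N})^t$. Consider erasure patterns of the following form. There is a set of consecutive indices $S = \{a, a+1, \dots, a+m-1\} \subseteq \{1, \dots, N\}$, and exactly the entries $y_i$ and $y_{i+N}$ for $i \in S$ are erased. The total number of erased entries is therefore $2m$. Then: (i) If $2m \le N$, the vector $x$ is uniquely determined by the non-erased entries of $y$. That is, for any $x, x' \in \mathbb{R}^N$, if $\mathbf{T}x$ and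 $\mathbf{T}x'$ agree on all non-erased coordinates, then $x = x'$. (ii) If the number of erased entries exceeds $N$, then $x$ is not uniquely determined by the non-erased entries of $y$. So this scheme recovers from up to $N$ such consecutive erasures and no more.
   Context: This is a rate-$1/2$ ''turbo-like'' encoder over the reals. The data block $x$ of length $N$ (the interleaver size) is encoded by a two-channel critically sampled filter bank with analysis filters $h_0, h_1$; this is the matrix $\mathbf{T}_s$. The same block is also encoded with the rows of $\mathbf{T}_s$ interleaved by $\Pi$; this is the matrix $\mathbf{T}_\Pi$. The two outputs are stacked into a vector of length $2N$. The channel only erases entries, and the erasure of $y_i$ is always accompanied by the erasure of $y_{i+N}$. The filter bank is critically sampled with perfect reconstruction, so $\mathbf{T}_s$ is an invertible square matrix. *)

(* Defs.v *)
From mathcomp Require Import all_boot all_order all_algebra.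
From mathcomp Require Import reals.

Set Implicit Arguments.
Unset Strict Implicit.
Unset Printing Implicit Defensive.

Import GRing.Theory.
Local Open Scope ring_scope.

(* Rows, columns and indices are numbered from 0: the row, column or index
   numbered k + 1 in the usual 1-based numbering is the ordinal k here. *)

(* Row i = 2m + c (c = odd i, 2m = i./2.*2). For L <= N at most one l : 'I_L
   satisfies the condition of the pick, and rev_ord l is L - 1 - l. *)
Definition filter_bank_mx (R : realType) (N L : nat) (h0 h1 : 'rV[R]_L) :
    'M[R]_N :=
  \matrix_(i < N, j < N)
    if [pick l : 'I_L | ((i./2.*2 + l) %% N)%N == j :> nat] is Some l
    then (if odd i then h1 else h0) 0 (rev_ord l) else 0.

Lemma interleaver_subproof (N : nat) (i : 'I_N) : ((i + N./2) %% N < N)%N.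
Proof. by rewrite ltn_mod (leq_ltn_trans (leq0n i) (ltn_ord i)). Qed.

Definition interleaver (N : nat) (i : 'I_N) : 'I_N :=
  Ordinal (interleaver_subproof i).

Definition encoder_mx (R : realType) (N L : nat) (h0 h1 : 'rV[R]_L) :
    'M[R]_(N + N, N) :=
  let Ts := filter_bank_mx N h0 h1 in col_mx Ts (rowsub (@interleaver N) Ts).

Definition consecutive (N a m : nat) : {set 'I_N} :=
  [set i : 'I_N | (a <= i < a + m)%N].

Definition paired_erasure (N : nat) (S : {set 'I_N}) : {set 'I_(N + N)} :=
  [set lshift N i | i in S] :|: [set rshift N i | i in S].

Lemma card_paired_erasure (N a m : nat) : (a + m <= N)%N ->
  #|paired_erasure (consecutive N a m)| = (2 * m)%N.
Proof.
move=> amN.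
have cS : #|consecutive N a m| = m.
  rewrite /consecutive -sum1dep_card.
  rewrite -(big_mkord (fun i => a <= i < a + m)%N (fun=> 1%N)).
  rewrite (big_cat_nat (n := a)) //=; last exact: leq_trans (leq_addr _ _) amN.
  rewrite (big_cat_nat (m := a) (n := a + m)) ?leq_addr //=.
  rewrite big_nat_cond big_pred0 => [|i]; last by case: (leqP a i); rewrite ?andbF.
  rewrite [X in (_ + (_ + X))%N]big_nat_cond [X in (_ + (_ + X))%N]big_pred0.
    rewrite big_nat_cond (eq_bigl (fun i => (a <= i < a + m)%N && true)).
      by rewrite -big_nat_cond sum_nat_const_nat addKn muln1 addn0 add0n.
    by move=> i; rewrite andbT andbb.
  by move=> i; case: (leqP (a + m) i); rewrite ?andbF.
rewrite /paired_erasure cardsU (card_imset _ (@lshift_inj _ _)).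
rewrite (card_imset _ (@rshift_inj _ _)) cS mul2n -addnn.
rewrite (_ : _ :&: _ = set0) ?cards0 ?subn0 //.
apply/setP=> k; rewrite !inE; apply/negP=> /andP[/imsetP[i _ ->]].
by move=> /imsetP[j _ /eqP]; rewrite eq_lrshift.
Qed.

Definition uniquely_determined (R : realType) (M N : nat) (T : 'M[R]_(M, N))
    (E : {set 'I_M}) (x : 'cV[R]_N) : Prop :=
  forall x' : 'cV[R]_N,
    (forall k : 'I_M, k \notin E -> (T *m x) k 0 = (T *m x') k 0) -> x = x'.

(* Main.v *)
(** Since the bank is invertible, knowing [x] is knowing all [N] coefficients
    [Ts x], and coefficient [i] is sent twice, at positions [i] and
    [N + j] with [interleaver j = i].  So [x] can be recovered iff every erased
    coefficient [i] of the first block has its second copy [j] outside of the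
    erased window.  The interleaver shifts by [N/2] modulo [N]: two indices at
    cyclic distance [N/2] fit in a window of length [m] inside [0, N) iff
    [N/2 < m]. *)

Require Import Defs.
From mathcomp Require Import all_boot all_order all_algebra.
From mathcomp Require Import reals.
From mathcomp Require Import zify.

Import GRing.Theory.
Local Open Scope ring_scope.

Lemma lshift_paired_erasure (N : nat) (S : {set 'I_N}) (i : 'I_N) :
  (lshift N i \in paired_erasure S) = (i \in S).
Proof.
rewrite inE mem_imset; last exact: lshift_inj.
case: imsetP => [[j _ /eqP]|_]; last by rewrite orbF.
by rewrite eq_lrshift.
Qed.

Lemma rshift_paired_erasure (N : nat) (S : {set 'I_N}) (i : 'I_N) :
  (rshift N i \in paired_erasure S) = (i \in S).
Proof.
rewrite inE orbC mem_imset; last exact: rshift_inj.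
case: imsetP => [[j _ /eqP]|_]; last by rewrite orbF.
by rewrite eq_rlshift.
Qed.

Lemma mul_col_rowsub_lshift (R : realType) (N : nat) (A : 'M[R]_N)
    (f : 'I_N -> 'I_N) (x : 'cV[R]_N) (i : 'I_N) :
  (col_mx A (rowsub f A) *m x) (lshift N i) 0 = (A *m x) i 0.
Proof. by rewrite mul_col_mx col_mxEu. Qed.

Lemma mul_col_rowsub_rshift (R : realType) (N : nat) (A : 'M[R]_N)
    (f : 'I_N -> 'I_N) (x : 'cV[R]_N) (i : 'I_N) :
  (col_mx A (rowsub f A) *m x) (rshift N i) 0 = (A *m x) (f i) 0.
Proof. by rewrite mul_col_mx col_mxEd mul_rowsub_mx mxE. Qed.

(** As [A] is onto, a coefficient with no surviving copy can be changed at will. The criterion is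
    free of [x], so it settles both claims at once. *)
Lemma uniquely_determined_paired_erasure (R : realType) (N : nat)
    (A : 'M[R]_N) (f : 'I_N -> 'I_N) (S : {set 'I_N}) (x : 'cV[R]_N) :
  A \in unitmx ->
  uniquely_determined (col_mx A (rowsub f A)) (paired_erasure S) x <->
  (forall i, i \in S -> exists2 j, j \notin S & f j = i).
Proof.
move=> A_unit; split=> [det i iS | cover x' agree].
  case: (boolP [exists j, (j \notin S) && (f j == i)]).
    by case/existsP=> j /andP[jS /eqP fj]; exists j.
  move/existsPn=> no_copy; exfalso.
  (* The codewords of [x] and of this perturbation differ only in the two
     copies of coefficient [i], both of which are erased. *)
  pose x' := x + invmx A *m delta_mx i 0.
  have Ax' j : j != i -> (A *m x') j 0 = (A *m x) j 0.
    by move=> /negPf ji; rewrite mulmxDr mulKVmx // !mxE ji addr0.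
  have /(congr1 (fun z => (A *m z) i 0)) : x = x'.
    apply: det => k; case: (split_ordP k) => j ->.
      rewrite lshift_paired_erasure !mul_col_rowsub_lshift => jS; rewrite Ax' //.
      by apply: contraNneq jS => ->.
    rewrite rshift_paired_erasure !mul_col_rowsub_rshift => jS.
    by rewrite Ax' //; have := no_copy j; rewrite jS.
  rewrite mulmxDr mulKVmx // !mxE !eqxx => /eqP.
  by rewrite -subr_eq0 opprD addNKr oppr_eq0 oner_eq0.
(* A coefficient outside [S] is read from its first copy, one in [S] from the second copy given by
   [cover]. *)
have eqA i : (A *m x) i 0 = (A *m x') i 0.
  have [/cover[j jS <-] | iS] := boolP (i \in S).
    have := agree (rshift N j); rewrite rshift_paired_erasure => /(_ jS).
    by rewrite !mul_col_rowsub_rshift.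
  have := agree (lshift N i); rewrite lshift_paired_erasure => /(_ iS).
  by rewrite !mul_col_rowsub_lshift.
rewrite -(mulKmx A_unit x) -(mulKmx A_unit x'); congr (_ *m _).
by apply/matrixP=> i k; rewrite ord1.
Qed.

(** Since [i + N./2 < 2 * N], at most one subtraction replaces the modulus, which leaves linear
    arithmetic for [lia]. *)
Lemma interleaverE (N : nat) (i : 'I_N) :
  interleaver i =
    (if (i + N./2 < N)%N then i + N./2 else i + N./2 - N)%N :> nat.
Proof.
have iN := ltn_ord i; rewrite /=; case: ltnP => [/modn_small //|Ni].
by rewrite -[in LHS](subnK Ni) modnDr modn_small //; lia.
Qed.

Lemma interleaverK (N : nat) : ~~ odd N -> involutive (@interleaver N).
Proof.
move=> N_even i; apply: val_inj => /=.
rewrite modnDml -addnA addnn even_halfK // modnDr modn_small //.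
Qed.

Theorem theorem1 (R : realType) (N L : nat) (h0 h1 : 'rV[R]_L)
    (N_gt0 : (0 < N)%N) (N_even : ~~ odd N) (L_gt0 : (0 < L)%N)
    (L_le_N : (L <= N)%N)
    (Ts_inv : filter_bank_mx N h0 h1 \in unitmx)
    (a m : nat) (am_le_N : (a + m <= N)%N) :
  let T := encoder_mx N h0 h1 in
  let E := paired_erasure (consecutive N a m) in
  ((2 * m <= N)%N -> forall x : 'cV[R]_N, uniquely_determined T E x) /\
  ((N < #|E|)%N -> forall x : 'cV[R]_N, ~ uniquely_determined T E x).
Proof.
move=> T E; have N2 := even_halfK N_even; split=> [mN x | ].
  apply/(uniquely_determined_paired_erasure _ _ _ _ _ _ Ts_inv) => i.
  (* Being an involution, the interleaver puts the second copy of [i] at [interleaver i], at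
     distance [N./2 >= m] from [i], hence outside the window. *)
  rewrite inE => iS; exists (interleaver i); last exact: interleaverK.
  by rewrite inE interleaverE; have := ltn_ord i; case: ifP; lia.
rewrite card_paired_erasure // => Nm x.
move/(uniquely_determined_paired_erasure _ _ _ _ _ _ Ts_inv) => cover.
(* The coefficient [a + N./2] loses both copies: [N./2 < m] keeps it in the window without wrapping,
   and its only second copy sits at [a], also erased. *)
have aN : (a < N)%N by lia.
have : interleaver (Ordinal aN) \in consecutive N a m.
  by rewrite inE interleaverE /=; case: ifP; lia.
case/cover=> j jS /(can_inj (interleaverK _ N_even)) ja.
by move: jS; rewrite ja inE /=; lia.
Qed.
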